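(* Let $k$ be a field of characteristic zero and $R=k[x,y,z]$ the standard graded polynomial ring. Let $$L_1=a_1x+a_2y+a_3z,\quad L_2=a_4x+a_5y+a_6z,\quad L_3=a_7x+a_8y+a_9z\qquad(a_i\in k)$$ be linear forms such that at least one of the $2\times2$ minors $$Q_1=xL_2-yL_1,\quad Q_2=xL_3-zL_1,\quad Q_3=yL_3-zL_2$$ of the matrix $\begin{bmatrix}x&y&z\\L_1&L_2&L_3\end{bmatrix}$ does not vanish. Let $$\Theta=\begin{bmatrix}(Q_1)_x&(Q_2)_x&(Q_3)_x\\(Q_1)_y&(Q_2)_y&(Q_3)_y\\(Q_1)_z&(Q_2)_z&(Q_3)_z\end{bmatrix}$$ be the Jacobian matrix of $Q_1,Q_2,Q_3$. If the cubic $f:=\det\Theta$ is non-zero and reduced, then $f$ is a linear free divisor. Precisely, a free basis of $T_{R/k}(f)$ is $\{\theta_1,\theta_2,\varepsilon_3\}$, where $\varepsilon_3=x\frac{\partial}{\partial x}+y\frac{\partial}{\partial y}+z\frac{\partial}{\partial z}$ is the Euler derivation, $\theta_2=L_1\frac{\partial}{\partial x}+L_2\frac{\partial}{\partial y}+L_3\frac{\partial}{\partial z}$, and $$\theta_1=(a_1L_1+a_2L_2+a_3L_3)\frac{\partial}{\partial x}+(a_4L_1+a_5L_2+a_6L_3)\frac{\partial}{\partial y}+(a_7L_1+a_8L_2+a_9L_3)\frac{\partial}{\partial z}.$$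
   Context: Polynomials $f$ to which the terms below apply are non-zero, homogeneous, reduced (a product of distinct irreducible factors), contained in $(x,y,z)^2$, with $k$-linearly independent partial derivatives (standing convention). $J_f=(f_x,f_y,f_z)$ is the Jacobian ideal; $T_{R/k}(f)=\{\theta\in{\rm Der}_k(R):\theta(f)\in(f)\}$ is the $R$-module of logarithmic derivations. $f$ is a free divisor if $T_{R/k}(f)$ is a free $R$-module; it is a linear free divisor if moreover $J_f$ is linearly presented, i.e. has a minimal graded free resolution $0\to R(-3)^2\to R(-2)^3\to J_f\to0$. *)

(* Defs.v *)
From HB Require Import structures.
From mathcomp Require Import all_boot all_order all_algebra.
From mathcomp Require Import mpoly.

Set Implicit Arguments.
Unset Strict Implicit.
Unset Printing Implicit Defensive.

Import GRing.Theory.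
Local Open Scope ring_scope.

(* k[x, y, z] is {mpoly k[3]}, with x, y, z the variables of index 0, 1, 2. *)
Notation varx := ('X_(0 : 'I_3)).
Notation vary := ('X_(1 : 'I_3)).
Notation varz := ('X_(2 : 'I_3)).

Definition vec3 (T : Type) (u v w : T) (i : 'I_3) : T := nth u [:: u; v; w] i.

Definition in_ideal (k : fieldType) (I : finType) (g : I -> {mpoly k[3]})
    (p : {mpoly k[3]}) : Prop :=
  exists c : I -> {mpoly k[3]}, p = \sum_i c i * g i.

Definition in_jacobian_ideal (k : fieldType) (f : {mpoly k[3]}) :
    {mpoly k[3]} -> Prop :=
  in_ideal (fun i : 'I_3 => f^`M(i)).

Definition irreducible_mpoly (k : fieldType) (p : {mpoly k[3]}) : Prop :=
  [/\ p != 0, p \isn't a GRing.unit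
    & forall q r : {mpoly k[3]}, p = q * r ->
        (q \is a GRing.unit) \/ (r \is a GRing.unit)].

Definition associated (k : fieldType) (p q : {mpoly k[3]}) : Prop :=
  exists2 u : {mpoly k[3]}, u \is a GRing.unit & p = u * q.

(* Factors are distinct in the sense of unique factorization, i.e. up to
   multiplication by a unit. *)
Definition reduced (k : fieldType) (f : {mpoly k[3]}) : Prop :=
  exists (n : nat) (p : 'I_n -> {mpoly k[3]}),
    [/\ forall i, irreducible_mpoly (p i),
        forall i j, i != j -> ~ associated (p i) (p j)
      & f = \prod_i p i].

Definition standing_convention (k : fieldType) (f : {mpoly k[3]}) : Prop :=
  [/\ f != 0,
      exists d : nat, f \is d.-homog,
      reduced f,
      in_ideal (fun ij : 'I_3 * 'I_3 => 'X_(ij.1) * 'X_(ij.2)) f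
    & forall c : 'I_3 -> k,
        \sum_i c i *: f^`M(i) = 0 -> forall i, c i = 0].

Definition derivation (k : fieldType) (D : {mpoly k[3]} -> {mpoly k[3]}) :
    Prop :=
  (forall (c : k) (p q : {mpoly k[3]}), D (c *: p + q) = c *: D p + D q) /\
  (forall p q : {mpoly k[3]}, D (p * q) = D p * q + p * D q).

Definition log_derivation (k : fieldType) (f : {mpoly k[3]})
    (D : {mpoly k[3]} -> {mpoly k[3]}) : Prop :=
  derivation D /\ exists g : {mpoly k[3]}, D f = g * f.

(* The derivation g 0 * d/dx + g 1 * d/dy + g 2 * d/dz. *)
Definition vector_field (k : fieldType) (g : 'I_3 -> {mpoly k[3]})
    (p : {mpoly k[3]}) : {mpoly k[3]} :=
  \sum_i g i * p^`M(i).

(* T is an R-submodule of the R-module of all maps R -> R, R = k[x, y, z]. *)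
Definition free_basis (k : fieldType)
    (T : ({mpoly k[3]} -> {mpoly k[3]}) -> Prop) (n : nat)
    (b : 'I_n -> {mpoly k[3]} -> {mpoly k[3]}) : Prop :=
  [/\ forall i, T (b i),
      forall D, T D ->
        exists c : 'I_n -> {mpoly k[3]}, forall p, D p = \sum_i c i * b i p
    & forall c : 'I_n -> {mpoly k[3]},
        (forall p, \sum_i c i * b i p = 0) -> forall i, c i = 0].

(* Freeness only needs finite bases: the module of logarithmic derivations is
   finitely generated, R being Noetherian. *)
Definition free_divisor (k : fieldType) (f : {mpoly k[3]}) : Prop :=
  standing_convention f /\
  exists (n : nat) (b : 'I_n -> {mpoly k[3]} -> {mpoly k[3]}),
    free_basis (log_derivation f) b.

(* J has a minimal graded free resolution
     0 -> (+)_j R(- e j) --phi--> (+)_i R(- d i) --g--> J -> 0.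
   The condition on the supports of the entries of phi says that phi is
   homogeneous of degree 0 for these shifts, and minimality is the requirement
   that these entries lie in (x, y, z). *)
Definition min_graded_resolution (k : fieldType) (J : {mpoly k[3]} -> Prop)
    (m n : nat) (d : 'I_m -> nat) (e : 'I_n -> nat) : Prop :=
  exists (g : 'rV[{mpoly k[3]}]_m) (phi : 'M[{mpoly k[3]}]_(m, n)),
    [/\ (forall i, g 0 i \is (d i).-homog) /\
        (forall i j (t : 'X_{1..3}),
           t \in msupp (phi i j) -> (mdeg t + d i)%N = e j),
        forall i j, in_ideal (fun l : 'I_3 => 'X_l) (phi i j),
        forall p, J p <-> exists v : 'cV_m, p = (g *m v) 0 0,
        forall v : 'cV_m, g *m v = 0 <-> exists w : 'cV_n, v = phi *m w
      & forall w : 'cV_n, phi *m w = 0 -> w = 0].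

Definition linearly_presented (k : fieldType) (J : {mpoly k[3]} -> Prop) :
    Prop :=
  min_graded_resolution J (fun _ : 'I_3 => 2) (fun _ : 'I_2 => 3).

Definition linear_free_divisor (k : fieldType) (f : {mpoly k[3]}) : Prop :=
  free_divisor f /\ linearly_presented (in_jacobian_ideal f).

Definition jacobian_matrix (k : fieldType) (Q : 'I_3 -> {mpoly k[3]}) :
    'M[{mpoly k[3]}]_3 :=
  \matrix_(i, j) (Q j)^`M(i).

(* Main.v *)
Require Import Defs.
From HB Require Import structures.
From mathcomp Require Import all_boot all_order all_algebra.
From mathcomp Require Import perm mpoly ring.
From Stdlib Require Import Classical.

Set Implicit Arguments.
Unset Strict Implicit.
Unset Printing Implicit Defensive.

Import GRing.Theory.
Local Open Scope ring_scope.

(** Let [A] be the matrix of the [a_i] and [v = (x, y, z)]. The coefficient rows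
    of [theta1], [theta2], [eps3] are [AAv], [Av] and [v], and the cubic [f]
    equals [2 * det (AAv, Av, v)] (lemma [jacobian_det_linear_fields]). A
    matrix [B] in [k[A]] commutes with [A], so the linear field [Bv] multiplies
    [det (AAv, Av, v)] by the trace of [B] ([linear_fields_eigen]). The three
    fields are thus logarithmic with a determinant which is [f] up to a nonzero
    scalar, and Saito's criterion ([saito_criterion]) says that they form a
    basis.

    Saito's criterion rests on the fact that, for [f] reduced in characteristic
    zero, only multiples [h] of [f] make all [h * f_x], [h * f_y], [h * f_z]
    multiples of [f] ([reduced_dvd_mderiv]). This is checked on one irreducible
    factor of [f] at a time and needs those factors to be prime, that is, unique
    factorization in [k[x, y, z]]. That is Gauss's theorem
    ([poly_irreducible_prime]), applied to one variable after the other
    ([mpoly_factorial]).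

    Everything else follows from the basis of linear fields. Each [theta_i]
    multiplies [f] by a scalar [c_i], with [c_3 = 3] by Euler's formula, so the
    relations between the partial derivatives of [f] are freely generated by the
    coefficient columns of [3 * theta_i - c_i * eps3] for [i = 1, 2], whose
    entries are linear ([linear_basis_presentation]); and a constant vector
    field killing [f] would be a combination of fields vanishing at the origin
    ([linear_basis_standing]). *)

(** * Irreducible polynomials are prime *)

Definition divides (R : nzRingType) (a b : R) : Prop := exists c, b = c * a.

Definition irreducible_elt (R : idomainType) (p : R) : Prop :=
  [/\ p != 0, p \isn't a GRing.unit
    & forall q r : R, p = q * r -> q \is a GRing.unit \/ r \is a GRing.unit].

Definition prime_elt (R : idomainType) (p : R) : Prop :=
  forall a b : R, divides p (a * b) -> divides p a \/ divides p b.

(** Unique factorization. The size function, which decreases along proper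
    divisors, is what yields the existence of factorizations; it is a form of
    that condition which a polynomial ring satisfies by its degree. *)
Definition is_factorial (R : idomainType) : Prop :=
  (forall p : R, irreducible_elt p -> prime_elt p) /\
  exists sz : R -> nat, forall a b : R,
    a * b != 0 -> a \isn't a GRing.unit -> (sz b < sz (a * b)%R)%N.

Lemma exists_irreducible_divisor (R : idomainType) (a : R) :
  is_factorial R -> a != 0 -> a \isn't a GRing.unit ->
  exists2 p, irreducible_elt p & divides p a.
Proof.
case=> _ [sz hsz].
have [n] := ubnP (sz a); elim: n a => // n IHn a le_an a0 aN.
case: (classic (irreducible_elt a)) => [|nirr].
  by exists a => //; exists 1; rewrite mul1r.
case: (classic (exists q r, [/\ a = q * r, q \isn't a GRing.unit
                              & r \isn't a GRing.unit])) => [|nfac]; last first.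
  case: nirr; split=> // q r def_a; case: (boolP (q \is a GRing.unit)) => [|qN].
    by left.
  case: (boolP (r \is a GRing.unit)) => [|rN]; first by right.
  by case: nfac; exists q, r.
case=> q [r [def_a qN rN]].
have r0 : r != 0 by apply: contraNneq a0 => r0; rewrite def_a r0 mulr0.
have [|||p irr_p [c def_r]] := IHn r => //.
  by apply: leq_trans (hsz q r _ qN) _; rewrite -def_a.
by exists p => //; exists (q * c); rewrite def_a def_r mulrA.
Qed.

(** This is how the existence of factorizations gets used: a property of
    nonzero elements is proved one irreducible factor at a time. *)
Lemma factorial_ind (R : idomainType) (P : R -> Prop) :
  is_factorial R ->
  (forall u, u \is a GRing.unit -> P u) ->
  (forall c p, irreducible_elt p -> P c -> P (c * p)) ->
  forall c, c != 0 -> P c.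
Proof.
move=> factR Punit Pmul c; have [_ [sz hsz]] := factR.
have [n] := ubnP (sz c); elim: n c => // n IHn c le_cn c0.
case: (boolP (c \is a GRing.unit)) => [|cN]; first exact: Punit.
have [p irr_p [d def_c]] := exists_irreducible_divisor factR c0 cN.
have [_ pN _] := irr_p; rewrite def_c; apply: Pmul => //; apply: IHn.
  by apply: leq_trans (hsz p d _ pN) _; rewrite mulrC -def_c.
by apply: contraNneq c0 => d0; rewrite def_c d0 mul0r.
Qed.

(** Cancelling the leading terms divisible by [p] turns the usual argument on
    the first coefficients not divisible by [p] into an induction on sizes. *)
Lemma polyC_prime (R : idomainType) (p : R) :
  prime_elt p -> prime_elt p%:P.
Proof.
move=> pr_p a b.
have [n] := ubnP (size a + size b)%N; elim: n a b => // n IHn a b le_ab p_ab.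
have [-> | a0] := eqVneq a 0; first by left; exists 0; rewrite mul0r.
have [-> | b0] := eqVneq b 0; first by right; exists 0; rewrite mul0r.
have drop_lead (g : {poly R}) c : g != 0 -> lead_coef g = c * p ->
    exists2 h : {poly R}, (size h < size g)%N & g = h + c *: 'X^((size g).-1) * p%:P.
  move=> g0 def_c; exists (g - c *: 'X^((size g).-1) * p%:P); last by rewrite subrK.
  have sg : (0 < size g)%N by rewrite size_poly_gt0.
  rewrite -(ltn_predK sg) ltnS; apply/leq_sizeP => j le_j.
  rewrite coefB mulrC mul_polyC !coefZ coefXn.
  have [->|ne_j] := eqVneq j (size g).-1.
    by rewrite mulr1 mulrC -def_c /lead_coef subrr.
  rewrite mulr0 mulr0 subr0 nth_default //.
  by rewrite -(ltn_predK sg) ltn_neqAle eq_sym ne_j.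
have : divides p (lead_coef a * lead_coef b).
  case: p_ab => c def_ab; exists (lead_coef c).
  by rewrite -lead_coefM def_ab lead_coefM lead_coefC.
case/pr_p => -[c def_c].
- have [h lt_h def_a] := drop_lead a c a0 def_c.
  have [||[d def_h]|[d def_b]] := IHn h b _ _.
  + by rewrite -ltnS; apply: leq_trans le_ab; rewrite ltnS ltn_add2r.
  + case: p_ab => d def_ab; exists (d - c *: 'X^((size a).-1) * b).
    by rewrite mulrBl -def_ab {1}def_a mulrDl [_ * b * _]mulrAC addrK.
  + by left; exists (d + c *: 'X^((size a).-1)); rewrite mulrDl -def_h.
  + by right; exists d.
- have [h lt_h def_b] := drop_lead b c b0 def_c.
  have [||[d def_a]|[d def_h]] := IHn a h _ _.
  + by rewrite -ltnS; apply: leq_trans le_ab; rewrite ltnS ltn_add2l.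
  + case: p_ab => d def_ab; exists (d - a * (c *: 'X^((size b).-1))).
    by rewrite mulrBl -def_ab {1}def_b mulrDr mulrA addrK.
  + by left; exists d.
  + by right; exists (d + c *: 'X^((size b).-1)); rewrite mulrDl -def_h.
Qed.

(** A factorization up to the scalar [c] becomes an honest factorization:
    each irreducible factor of [c] is prime in [{poly R}], hence divides one of
    the two factors and can be cancelled there. *)
Lemma strip_content (R : idomainType) (c : R) (p q d : {poly R}) :
  is_factorial R -> c != 0 -> c%:P * p = q * d ->
  exists q1 d1 r s,
    [/\ r != 0, s != 0, p = q1 * d1 & r%:P * d1 = s%:P * d].
Proof.
move=> factR c0; have [prR _] := factR; move: c c0 q d.
apply: (factorial_ind factR) => [c cU q d def_cp | c p1 irr_p1 IHc q d def_cp].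
  exists (c^-1%:P * q), d, 1, 1; rewrite !oner_neq0; split=> //.
  by rewrite -mulrA -def_cp mulrA -polyCM mulVr // mul1r.
have [p10 _ _] := irr_p1; have p1P0 : p1%:P != 0 by rewrite polyC_eq0.
have : divides p1%:P (q * d).
  by exists (c%:P * p); rewrite -def_cp polyCM mulrAC.
case/(polyC_prime (prR _ irr_p1)) => [[q' def_q] | [d' def_d]].
- apply: (IHc q' d); apply: (mulIf p1P0).
  by rewrite mulrAC -polyCM def_cp def_q mulrAC.
- have [|q1 [d1 [r [s [r0 s0 def_p def_d1]]]]] := IHc q d'.
    apply: (mulIf p1P0).
    by rewrite mulrAC -polyCM def_cp def_d mulrA.
  exists q1, d1, (r * p1), s; rewrite mulf_neq0 //; split=> //.
  by rewrite polyCM mulrAC def_d1 def_d mulrA.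
Qed.

(** An irreducible polynomial of positive degree is primitive, so no prime
    factor of [c] divides it. *)
Lemma irreducible_dvd_polyCM (R : idomainType) (c : R) (p a : {poly R}) :
  is_factorial R -> irreducible_elt p -> (1 < size p)%N -> c != 0 ->
  divides p (c%:P * a) -> divides p a.
Proof.
move=> factR [_ _ irr_p] sz_p c0; have [prR _] := factR; move: c c0.
apply: (factorial_ind factR) => [c cU | c p1 irr_p1 IHc] [g def_ca].
  by exists (c^-1%:P * g); rewrite -mulrA -def_ca mulrA -polyCM mulVr // mul1r.
have [p10 p1N _] := irr_p1; have p1P0 : p1%:P != 0 by rewrite polyC_eq0.
have : divides p1%:P (g * p).
  by exists (c%:P * a); rewrite -def_ca polyCM mulrAC.
case/(polyC_prime (prR _ irr_p1)) => [[g' def_g] | [p' def_p]].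
  apply: IHc; exists g'; apply: (mulIf p1P0).
  by rewrite mulrAC -polyCM def_ca def_g mulrAC.
have [] := irr_p _ _ def_p.
  rewrite poly_unitE => /andP[/eqP sz_p' _].
  by move: sz_p; rewrite def_p mulrC size_Cmul // sz_p'.
by rewrite poly_unitE coefC eqxx (negPf p1N) andbF.
Qed.

(** Let [p] have positive degree and divide [a * b] but not [a]. An element [d]
    of least degree in the ideal [(p, a)] divides [p] and [a] up to scalars, by
    pseudo-division; stripping the scalar shows that [d] is either [p] up to
    scalars, which would make [p] divide [a], or a nonzero scalar. In the latter
    case [d * b] is a multiple of [p], hence so is [b]. *)
Lemma poly_irreducible_prime (R : idomainType) (p : {poly R}) :
  is_factorial R -> irreducible_elt p -> prime_elt p.
Proof.
move=> factR irr_p; have [p0 pN fac_p] := irr_p; have [prR _] := factR.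
have [sz_p | sz_p] := leqP (size p) 1.
  have def_p := size1_polyC sz_p; rewrite def_p; apply: polyC_prime; apply: prR.
  split.
  - by move: p0; rewrite {1}def_p polyC_eq0.
  - move: pN; rewrite {1}def_p poly_unitE coefC eqxx size_polyC.
    by have [->|] := eqVneq p`_0 0; rewrite ?unitr0.
  move=> q r def_qr; have [] := fac_p q%:P r%:P; first by rewrite -polyCM -def_qr.
    by rewrite poly_unitE coefC eqxx => /andP[_ ->]; left.
  by rewrite poly_unitE coefC eqxx => /andP[_ ->]; right.
move=> a b p_ab; case: (classic (divides p a)) => [|npa]; [by left | right].
pose I (d : {poly R}) := exists u v, d = u * p + v * a.
have [d [d0 Id min_d]] : exists d, [/\ d != 0, I d &
    forall g, I g -> (size g < size d)%N -> g = 0].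
  have Ip : I p by exists 1, 0; rewrite mul1r mul0r addr0.
  have [n] := ubnP (size p); move: (p) p0 Ip => d.
  elim: n d => // n IHn d d0 Id le_dn.
  case: (classic (exists g, [/\ g != 0, I g & (size g < size d)%N])).
    by case=> g [g0 Ig lt_g]; apply: (IHn g) => //; apply: leq_trans lt_g _.
  move=> nex; exists d; split=> // g Ig lt_g; apply/eqP; apply: contraT => g0.
  by case: nex; exists g.
have dvd_d g : I g -> exists c q, c != 0 /\ c%:P * g = q * d.
  move=> [u [v def_g]].
  exists (lead_coef d ^+ scalp g d), (g %/ d)%R.
  have lc0 : lead_coef d ^+ scalp g d != 0 by rewrite expf_neq0 ?lead_coef_eq0.
  split=> //; have := Pdiv.Idomain.divp_eq g d; rewrite -mul_polyC => def_cg.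
  have rem0 : (g %% d)%R = 0.
    apply: min_d; last by rewrite ltn_modp.
    case: Id => u' [v' def_d].
    exists ((lead_coef d ^+ scalp g d)%:P * u - (g %/ d)%R * u').
    exists ((lead_coef d ^+ scalp g d)%:P * v - (g %/ d)%R * v').
    have -> : (g %% d)%R = (lead_coef d ^+ scalp g d)%:P * g - (g %/ d)%R * d.
      by rewrite def_cg addrC addKr.
    move: (_%:P) (g %/ d)%R => C Q; rewrite def_d def_g; ring.
  by rewrite def_cg rem0 addr0.
have [|c [q [c0 def_cp]]] := dvd_d p; first by exists 1, 0; rewrite mul1r mul0r addr0.
have [|c' [q' [c'0 def_ca]]] := dvd_d a; first by exists 0, 1; rewrite mul1r mul0r add0r.
have [q1 [d1 [r [s [r0 s0 def_p def_d1]]]]] := strip_content factR c0 def_cp.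
case: (fac_p _ _ def_p) => [q1U | d1U].
  case: npa; apply: (irreducible_dvd_polyCM factR irr_p sz_p (mulf_neq0 s0 c'0)).
  exists (q' * r%:P * q1^-1).
  rewrite polyCM -mulrA def_ca mulrCA -def_d1 mulrA -!mulrA.
  by rewrite def_p mulKr.
have : size d = 1.
  have /eqP := congr1 (fun g : {poly R} => size g) def_d1.
  rewrite !size_Cmul // => /eqP <-.
  by move: d1U; rewrite poly_unitE => /andP[/eqP].
move=> /eqP/size_poly1P [e e0 def_e].
apply: (irreducible_dvd_polyCM factR irr_p sz_p e0).
case: Id => u [v def_d]; case: p_ab => w def_ab.
by exists (u * b + v * w); rewrite -def_e def_d !mulrDl -!mulrA def_ab [p * b]mulrC.
Qed.

Lemma irreducible_prime_iso (R S : idomainType) (phi : {rmorphism R -> S})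
    (psi : {rmorphism S -> R}) (p : R) :
  cancel phi psi -> cancel psi phi ->
  (irreducible_elt (phi p) -> prime_elt (phi p)) ->
  irreducible_elt p -> prime_elt p.
Proof.
move=> phiK psiK prS [p0 pN fac_p].
have unit_psi q : (psi q \is a GRing.unit) -> q \is a GRing.unit.
  by move/(rmorph_unit phi); rewrite psiK.
have unit_phi q : (phi q \is a GRing.unit) -> q \is a GRing.unit.
  by move/(rmorph_unit psi); rewrite phiK.
move=> a b [c def_ab].
have [||[d def_a]|[d def_b]] := prS _ (phi a) (phi b).
- split.
  + by rewrite -(rmorph0 phi) (can_eq phiK).
  + by apply: contra pN => /unit_phi.
  + move=> q r def_p; have [|/unit_psi|/unit_psi] := fac_p (psi q) (psi r).
    * by rewrite -rmorphM -def_p phiK.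
    * by left.
    * by right.
- by exists (phi c); rewrite -!rmorphM def_ab.
- by left; exists (psi d); rewrite -[a]phiK def_a rmorphM phiK.
- by right; exists (psi d); rewrite -[b]phiK def_b rmorphM phiK.
Qed.

Lemma mpoly_subring_ind (n : nat) (R : comNzRingType)
    (P : {mpoly R[n]} -> Prop) :
  (forall c, P c%:MP) -> (forall i, P 'X_i) ->
  (forall p q, P p -> P q -> P (p + q)) ->
  (forall p q, P p -> P q -> P (p * q)) -> forall p, P p.
Proof.
move=> PC PX PD PM; have P1 : P 1 by rewrite -mpolyC1.
apply: mpolyind => [|c m p hm hc Pp]; first by rewrite -mpolyC0.
apply: (PD) Pp; rewrite -mul_mpolyC; apply: (PM) => //.
rewrite mpolyXE_id; apply: (big_ind P) => [//|//|i _].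
by elim: (m i) => [|d IHd]; rewrite ?expr0 // exprS; apply: PM.
Qed.

(** [{mpoly k[n.+1]}] is [{poly {mpoly k[n]}}], the last variable becoming the
    polynomial variable; [muni] is one direction of this isomorphism. *)
Section LastVariable.

Variables (n : nat) (k : fieldType).

Definition poly_to_mpoly : {poly {mpoly k[n]}} -> {mpoly k[n.+1]} :=
  horner_eval 'X_ord_max \o map_poly (@mwiden n k).

HB.instance Definition _ := GRing.RMorphism.on poly_to_mpoly.

Lemma muniX_widen (i : 'I_n) :
  muni ('X_(widen_ord (leqnSn n) i) : {mpoly k[n.+1]}) = ('X_i)%:P.
Proof.
rewrite muniE msuppX big_seq1 mcoeffX eqxx scale1r mnmE -val_eqE /= ltn_eqF //.
rewrite expr0 alg_polyC; congr ('X_[_])%:P; apply/mnmP => j.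
by rewrite !mnmE -val_eqE.
Qed.

Lemma muniX_max : muni ('X_ord_max : {mpoly k[n.+1]}) = 'X.
Proof.
rewrite muniE msuppX big_seq1 mcoeffX eqxx scale1r mnmE eqxx expr1.
rewrite (_ : [multinom _ | _ < _] = 0%MM) ?mpolyX0 ?scale1r //.
by apply/mnmP => j; rewrite !mnmE -val_eqE /= gtn_eqF.
Qed.

Lemma muniK : cancel (@muni n k) poly_to_mpoly.
Proof.
move=> p; elim/mpoly_subring_ind: p => [c | i | p q IHp IHq | p q IHp IHq].
- by rewrite muniC /poly_to_mpoly /= map_polyC /= mwidenC /horner_eval hornerC.
- have [j ->|->] := unliftP ord_max i.
    have -> : lift ord_max j = widen_ord (leqnSn n) j.
      by apply: val_inj; rewrite /= /bump leqNgt ltn_ord.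
    rewrite muniX_widen /poly_to_mpoly /= map_polyC /= /horner_eval hornerC.
    by rewrite mwidenX mnmwiden1.
  by rewrite muniX_max /poly_to_mpoly /= map_polyX /horner_eval hornerX.
- by rewrite -[in RHS]IHp -[in RHS]IHq !rmorphD.
- by rewrite -[in RHS]IHp -[in RHS]IHq !rmorphM.
Qed.

Lemma poly_to_mpolyK : cancel poly_to_mpoly (@muni n k).
Proof.
move=> p; rewrite /poly_to_mpoly /= /horner_eval.
elim/poly_ind: p => [|p c IHp]; first by rewrite !rmorph0 horner0 muni0.
rewrite rmorphD rmorphM /= map_polyX map_polyC hornerMXaddC.
rewrite rmorphD rmorphM /= IHp muniX_max; congr (_ + _).
elim/mpoly_subring_ind: c => [c | i | f g IHf IHg | f g IHf IHg] /=.
- by rewrite mwidenC muniC.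
- by rewrite mwidenX mnmwiden1 muniX_widen.
- by rewrite !rmorphD /= IHf IHg.
- by rewrite !rmorphM /= IHf IHg.
Qed.

End LastVariable.

Lemma mpolyC_unit (n : nat) (k : fieldType) (c : k) :
  c != 0 -> (c%:MP : {mpoly k[n]}) \is a GRing.unit.
Proof. by move=> c0; apply: (rmorph_unit (@mpolyC n k)); rewrite unitfE. Qed.

Lemma msize_lt_mulr (n : nat) (k : fieldType) (a b : {mpoly k[n]}) :
  a * b != 0 -> a \isn't a GRing.unit -> (msize b < msize (a * b)%R)%N.
Proof.
move=> ab0 aN.
have := ab0; rewrite mulf_eq0 negb_or => /andP[a0 b0]; rewrite msizeM //.
have : (1 < msize a)%N.
  rewrite ltnNge; apply: contra aN => /msize1_polyC def_a.
  rewrite def_a mpolyC_unit //; apply: contraNneq a0 => c0.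
  by rewrite def_a c0 mpolyC0.
by case: (msize a) => [|[|d]] // _; rewrite !addSn ltnS leq_addl.
Qed.

Lemma mpoly_factorial (n : nat) (k : fieldType) : is_factorial {mpoly k[n]}.
Proof.
split; last by exists (fun p : {mpoly k[n]} => msize p); apply: msize_lt_mulr.
elim: n => [|n IHn] p.
  case=> p0 pN _; case/negP: pN; rewrite (nvar0_mpolyC p) mpolyC_unit //.
  by apply: contraNneq p0 => c0; rewrite (nvar0_mpolyC p) c0 mpolyC0.
apply: (irreducible_prime_iso (@muniK n k) (@poly_to_mpolyK n k)).
apply: poly_irreducible_prime; split=> //.
by exists (fun p : {mpoly k[n]} => msize p); apply: msize_lt_mulr.
Qed.

Lemma mpoly_irreducible_prime (k : fieldType) (p : {mpoly k[3]}) :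
  irreducible_mpoly p -> prime_elt p.
Proof. by move=> irr_p; have [pr _] := mpoly_factorial 3 k; exact: pr. Qed.

(** * Divisibility by a reduced polynomial *)

Lemma mderivXU (n : nat) (k : fieldType) (i j : 'I_n) :
  ('X_i : {mpoly k[n]})^`M(j) = (i == j)%:R.
Proof.
rewrite mderivX mnmE; case: eqP => [->|_]; last by rewrite scale0r.
rewrite (_ : U_(j) - U_(j) = 0)%MM ?mpolyX0 ?scale1r //.
by apply/mnmP => l; rewrite !mnmE subnn.
Qed.

Lemma msupp_mderiv (n : nat) (k : fieldType) (i : 'I_n) (p : {mpoly k[n]}) m :
  m \in msupp p^`M(i) -> (m + U_(i))%MM \in msupp p.
Proof.
rewrite !mcoeff_msupp mcoeff_deriv; apply: contraNneq => ->.
by rewrite mul0rn.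
Qed.

(** The derivative has smaller degree. *)
Lemma mderiv_dvd_eq0 (n : nat) (k : fieldType) (i : 'I_n) (p : {mpoly k[n]}) :
  divides p p^`M(i) -> p^`M(i) = 0.
Proof.
case=> c def_d; apply/eqP; apply: contraT => d0.
have c0 : c != 0 by apply: contraNneq d0 => c0; rewrite def_d c0 mul0r.
have p0 : p != 0 by apply: contraNneq d0 => p0; rewrite p0 mderiv0.
suff : (msize p^`M(i) < msize p)%N.
  rewrite def_d msizeM // ltnNge.
  have : (0 < msize c)%N by rewrite lt0n msize_poly_eq0.
  by case: (msize c) => // d _; rewrite addSn leq_addl.
have := msize_mdeg_lt (msupp_mderiv (mlead_supp d0)).
by rewrite mdegD mdeg1 addn1 mlead_deg.
Qed.

Lemma mderiv_eq0_mpolyC (n : nat) (k : fieldType) (p : {mpoly k[n]}) :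
  [pchar k] =i pred0 -> (forall i, p^`M(i) = 0) -> p = (p@_0)%:MP.
Proof.
move=> /pcharf0P char0 dp0; apply/mpolyP => m; rewrite mcoeffC.
have [->|m0] := eqVneq 0%MM m; first by rewrite mulr1.
rewrite mulr0; move: m0; rewrite eq_sym -mdeg_eq0 mdegE sum_nat_eq0.
case/forallPn => i; rewrite /= => mi.
have def_m : m = (m - U_(i) + U_(i))%MM by rewrite submK // lep1mP.
have := congr1 (mcoeff (m - U_(i))%MM) (dp0 i).
rewrite mcoeff_deriv -def_m mcoeff0 => /eqP.
by rewrite -mulr_natr mulf_eq0 char0 orbF => /eqP.
Qed.

Lemma prime_dvd_prod (R : idomainType) (I : eqType) (r : seq I) (F : I -> R) p :
  irreducible_elt p -> prime_elt p -> divides p (\prod_(i <- r) F i) ->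
  exists2 i, i \in r & divides p (F i).
Proof.
case=> _ pN _ pr_p; elim: r => [|i r IHr].
  rewrite big_nil => -[c def_c]; case/negP: pN; apply/unitrPr.
  by exists c; rewrite mulrC.
rewrite big_cons => /pr_p[p_i | /IHr[j jr p_j]].
  by exists i; rewrite ?mem_head.
by exists j; rewrite // inE jr orbT.
Qed.

Lemma irreducible_dvd_associated (k : fieldType) (p q : {mpoly k[3]}) :
  irreducible_mpoly p -> irreducible_mpoly q -> divides p q -> associated q p.
Proof.
move=> [_ pN _] [_ _ fac_q] [c def_q]; exists c => //.
by have [//|pU] := fac_q _ _ def_q; rewrite pU in pN.
Qed.

Lemma prod_primes_dvd (k : fieldType) (n : nat) (p : 'I_n -> {mpoly k[3]}) h :
  (forall i, irreducible_mpoly (p i)) ->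
  (forall i j, i != j -> ~ associated (p i) (p j)) ->
  (forall i, divides (p i) h) -> divides (\prod_i p i) h.
Proof.
move=> irr_p nassoc p_h.
have pr_p i := mpoly_irreducible_prime (irr_p i).
suff IH (r : seq 'I_n) : uniq r -> divides (\prod_(i <- r) p i) h.
  exact: IH (index_enum_uniq _).
elim: r => [|i r IHr] /=; first by exists h; rewrite big_nil mulr1.
case/andP=> ir /IHr[c def_h]; have := p_h i; rewrite def_h.
case/(pr_p i) => [[d def_c] | p_ir].
  by exists d; rewrite big_cons mulrA -def_c.
have [j jr p_ij] := prime_dvd_prod (irr_p i) (pr_p i) p_ir.
case: (nassoc j i); first by apply: contraNneq ir => <-.
exact: irreducible_dvd_associated.
Qed.

(** Let [p] be an irreducible factor of [f = p * g]. Modulo [p] a partial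
    derivative of [f] is that of [p] times [g]; [p] does not divide [g], and it
    cannot divide all its own partial derivatives, as these would then vanish
    for degree reasons and [p] would be constant. So [p] divides [h]. *)
Lemma reduced_dvd_mderiv (k : fieldType) (f h : {mpoly k[3]}) :
  [pchar k] =i pred0 -> reduced f ->
  (forall j : 'I_3, divides f (h * f^`M(j))) -> divides f h.
Proof.
move=> char0 [n [p [irr_p nassoc def_f]]] f_hd; rewrite def_f.
apply: prod_primes_dvd => // i.
have pr_i := mpoly_irreducible_prime (irr_p i).
have [pi0 piN _] := irr_p i.
pose g := \prod_(j | j != i) p j.
have {}def_f : f = p i * g by rewrite def_f (bigD1 i).
case: (classic (divides (p i) h)) => // nph; exfalso.
have npg : ~ divides (p i) g.
  rewrite /g -big_filter => /(prime_dvd_prod (irr_p i) pr_i)[j].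
  rewrite mem_filter => /andP[ji _] p_ij; apply: (nassoc j i) => //.
  exact: irreducible_dvd_associated.
have dp0 j : (p i)^`M(j) = 0.
  apply: mderiv_dvd_eq0.
  have : divides (p i) (h * ((p i)^`M(j) * g)).
    have [c def_c] := f_hd j; exists (c * g - h * g^`M(j)).
    move: def_c; rewrite def_f mderivM mulrDr => /(canRL (addrK _)) ->.
    by ring.
  by case/pr_i => // /pr_i[].
case/negP: piN; rewrite (mderiv_eq0_mpolyC char0 dp0) mpolyC_unit //.
apply: contraNneq pi0 => c0.
by rewrite (mderiv_eq0_mpolyC char0 dp0) c0 mpolyC0.
Qed.

(** * Logarithmic derivations and Saito's criterion *)

Section VectorFields.

Variable k : fieldType.
Implicit Types (f p q : {mpoly k[3]}) (g : 'I_3 -> {mpoly k[3]}).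

Lemma vector_fieldX g i : vector_field g 'X_i = g i.
Proof.
rewrite /vector_field (bigD1 i) //= big1 => [|j ji].
  by rewrite mderivXU eqxx mulr1 addr0.
by rewrite mderivXU eq_sym (negPf ji) mulr0.
Qed.

Lemma vector_field_derivation g : derivation (vector_field g).
Proof.
split=> [c p q | p q]; rewrite /vector_field.
  rewrite scaler_sumr -big_split; apply: eq_bigr => i _ /=.
  by rewrite mderivD mderivZ mulrDr scalerAr.
rewrite mulr_suml mulr_sumr -big_split; apply: eq_bigr => i _ /=.
by rewrite mderivM; ring.
Qed.

Lemma vector_fieldD g : {morph vector_field g : p q / p + q}.
Proof.
move=> p q; have [lin _] := vector_field_derivation g.
by rewrite -[p]scale1r lin !scale1r.
Qed.

Lemma vector_fieldM g p q :
  vector_field g (p * q) = vector_field g p * q + p * vector_field g q.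
Proof. by have [_] := vector_field_derivation g. Qed.

Lemma vector_fieldC g c : vector_field g c%:MP = 0.
Proof. by rewrite /vector_field big1 // => i _; rewrite mderivC mulr0. Qed.

Lemma vector_fieldN g : {morph vector_field g : p / - p}.
Proof.
move=> p; apply/eqP.
by rewrite -addr_eq0 -vector_fieldD addNr -mpolyC0 vector_fieldC.
Qed.

Lemma vector_fieldZ g c : {morph vector_field g : p / c *: p}.
Proof.
move=> p; rewrite -mul_mpolyC vector_fieldM vector_fieldC mul0r add0r.
by rewrite mul_mpolyC.
Qed.

(** Both sides are derivations that agree on constants and variables. *)
Lemma derivationE D p : derivation D -> D p = vector_field (fun i => D 'X_i) p.
Proof.
case=> Dlin Dmul; set V := vector_field _.
have [Vlin Vmul] : derivation V by apply: vector_field_derivation.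
have const0 (E : {mpoly k[3]} -> {mpoly k[3]}) :
    (forall c p q, E (c *: p + q) = c *: E p + E q) ->
    (forall p q, E (p * q) = E p * q + p * E q) -> forall c, E c%:MP = 0.
  move=> Elin Emul c; have E1 : E 1 = 0.
    have := Emul 1 1; rewrite !mulr1 mul1r => /esym/(canRL (addrK _)).
    by rewrite subrr.
  have E0 : E 0 = 0.
    have := Elin 1 0 0; rewrite scale1r addr0 scale1r => /esym/(canRL (addrK _)).
    by rewrite subrr.
  by have := Elin c 1 0; rewrite E1 E0 !addr0 scaler0 -mul_mpolyC mulr1.
elim/mpoly_subring_ind: p => [c | i | p q IHp IHq | p q IHp IHq].
- by rewrite !const0.
- by rewrite /V vector_fieldX.
- have := Dlin 1 p q; have := Vlin 1 p q.
  by rewrite !scale1r => -> ->; rewrite IHp IHq.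
- by rewrite Dmul Vmul IHp IHq.
Qed.

(** The product of [M] and the gradient of [f] is divisible by [f]; multiply it
    by the adjugate of [M]. *)
Lemma det_log_dvd f (M : 'M[{mpoly k[3]}]_3) j :
  (forall i, divides f (vector_field (M i) f)) -> divides f (\det M * f^`M(j)).
Proof.
move=> logM; pose grad : 'cV[{mpoly k[3]}]_3 := \col_i f^`M(i).
have -> : \det M * f^`M(j) = (\adj M *m (M *m grad)) j 0.
  by rewrite mulmxA mul_adj_mx mul_scalar_mx !mxE.
rewrite mxE; elim/big_ind: _ => [|_ _ [c ->] [d ->]|i _].
- by exists 0; rewrite mul0r.
- by exists (c + d); rewrite mulrDl.
have [c def_c] := logM i; exists (\adj M j i * c); rewrite -mulrA -def_c.
by congr (_ * _); rewrite mxE; apply: eq_bigr => l _; rewrite mxE.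
Qed.

Lemma cramer_row (R : comNzRingType) (n : nat) (M : 'M[R]_n) (u : 'rV[R]_n) i :
  (u *m \adj M) 0 i = \det (\matrix_(a, b) if a == i then u 0 b else M a b).
Proof.
rewrite (expand_det_row _ i) mxE; apply: eq_bigr => j _; rewrite !mxE eqxx.
congr (_ * _); rewrite /cofactor; congr (_ * \det _).
by apply/matrixP => a b; rewrite !mxE eq_sym (negPf (neq_lift _ _)).
Qed.

(** Cramer's rule writes [\det M] times a logarithmic vector field [u] as a
    combination of the [theta i] whose coefficients are determinants of
    matrices with logarithmic rows. By [det_log_dvd] and [reduced_dvd_mderiv]
    these are multiples of [f], and [\det M] is [f] up to a scalar. *)
Lemma saito_criterion f (theta : 'I_3 -> 'I_3 -> {mpoly k[3]}) (c : k)
    (b : 'I_3 -> {mpoly k[3]} -> {mpoly k[3]}) :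
  [pchar k] =i pred0 -> f != 0 -> reduced f -> c != 0 ->
  (forall i, b i = vector_field (theta i)) ->
  (forall i, divides f (vector_field (theta i) f)) ->
  \det (\matrix_(i, j) theta i j) = c *: f ->
  free_basis (log_derivation f) b.
Proof.
move=> char0 f0 red_f c0 def_b log_theta; set M := (\matrix_(i, j) _) => detM.
have detM0 : \det M != 0 by rewrite detM -mul_mpolyC mulf_neq0 ?mpolyC_eq0.
split.
- move=> i; rewrite def_b; split; first exact: vector_field_derivation.
  by case: (log_theta i) => g def_g; exists g.
- move=> D [derD [g def_g]]; pose u : 'rV[{mpoly k[3]}]_3 := \row_i D 'X_i.
  have f_dvd i : divides f ((u *m \adj M) 0 i).
    rewrite cramer_row; apply: (reduced_dvd_mderiv char0 red_f) => j.
    apply: det_log_dvd => a.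
    have [def_a | ai] := eqVneq a i.
      exists g; rewrite -def_g [RHS]derivationE //; apply: eq_bigr => l _.
      by rewrite !mxE def_a eqxx.
    have [d def_d] := log_theta a; exists d; rewrite -def_d.
    by apply: eq_bigr => l _; rewrite !mxE (negPf ai).
  have [w def_w] : exists w : 'I_3 -> {mpoly k[3]},
      forall i, (u *m \adj M) 0 i = w i * f.
    exact: (@fin_all_exists _ _ (fun i w => (u *m \adj M) 0 i = w * f) f_dvd).
  have Dw i : D 'X_i = \sum_j (c^-1 *: w j) * theta j i.
    apply: (mulfI detM0).
    have -> : \det M * D 'X_i = (u *m \adj M *m M) 0 i.
      by rewrite -mulmxA mul_adj_mx mul_mx_scalar !mxE.
    rewrite mxE mulr_sumr detM; apply: eq_bigr => j _.
    rewrite def_w mxE -!scalerAl -scalerAr scalerA divff // scale1r.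
    by rewrite mulrCA mulrA.
  exists (fun j => c^-1 *: w j) => p; rewrite derivationE //.
  rewrite /vector_field (eq_bigr _ (fun i _ => congr1 (fun q => q * _) (Dw i))).
  under eq_bigr do rewrite mulr_suml.
  rewrite exchange_big; apply: eq_bigr => j _; rewrite def_b /vector_field mulr_sumr.
  by apply: eq_bigr => i _; rewrite mulrA.
- move=> w w0 i; pose v : 'rV[{mpoly k[3]}]_3 := \row_i w i.
  have vM : v *m M = 0.
    apply/rowP => j; rewrite !mxE -[RHS](w0 'X_j); apply: eq_bigr => l _.
    by rewrite !mxE def_b vector_fieldX.
  have /rowP/(_ i) : \det M *: v = 0.
    by rewrite -mul_mx_scalar -mul_mx_adj mulmxA vM mul0mx.
  by rewrite !mxE => /eqP; rewrite mulf_eq0 (negPf detM0) => /eqP.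
Qed.

End VectorFields.

(** * Homogeneous polynomials *)

Lemma dhomog_mderiv (n : nat) (k : fieldType) (i : 'I_n) d (p : {mpoly k[n]}) :
  p \is d.+1.-homog -> p^`M(i) \is d.-homog.
Proof.
move=> /dhomogP hp; apply/dhomogP => m /msupp_mderiv/hp /eqP.
by rewrite /= mdegD mdeg1 addn1 eqSS => /eqP.
Qed.

(** Euler's formula, checked on monomials. *)
Lemma euler_homog (n : nat) (k : fieldType) d (p : {mpoly k[n]}) :
  p \is d.-homog -> \sum_i 'X_i * p^`M(i) = d%:R *: p.
Proof.
move=> /dhomogP hp; rewrite [in RHS](mpolyE p) scaler_sumr.
under eq_bigr => i _.
  rewrite {1}(mpolyE p) raddf_sum /= mulr_sumr.
  over.
rewrite exchange_big /= big_seq [RHS]big_seq; apply: eq_bigr => m /hp <-.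
rewrite /= mdegE natr_sum scaler_suml; apply: eq_bigr => i _.
rewrite mderivZ mderivX scalerA -scalerAr [in RHS]scalerA [in RHS]mulrC.
have [->|mi] := eqVneq (m i) 0%N; first by rewrite mulr0 !scale0r.
by rewrite -mpolyXD addmC submK // lep1mP.
Qed.

Lemma dhomog_in_ideal (k : fieldType) d (p : {mpoly k[3]}) :
  [pchar k] =i pred0 -> p \is d.+1.-homog -> in_ideal (fun l : 'I_3 => 'X_l) p.
Proof.
move=> /pcharf0P char0 /euler_homog ep; exists (fun i => d.+1%:R^-1 *: p^`M(i)).
under eq_bigr do rewrite -scalerAl mulrC.
by rewrite -scaler_sumr ep scalerA mulVf ?scale1r // char0.
Qed.

Lemma dhomog_in_ideal2 (k : fieldType) d (p : {mpoly k[3]}) :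
  [pchar k] =i pred0 -> p \is d.+2.-homog ->
  in_ideal (fun ij : 'I_3 * 'I_3 => 'X_(ij.1) * 'X_(ij.2)) p.
Proof.
move=> char0 hp; have dp i := dhomog_in_ideal char0 (dhomog_mderiv i hp).
have [w def_w] : exists w : 'I_3 -> 'I_3 -> {mpoly k[3]},
    forall i, p^`M(i) = \sum_j w i j * 'X_j.
  exact: fin_all_exists dp.
have /pcharf0P charP := char0.
exists (fun ij => d.+2%:R^-1 *: w ij.1 ij.2).
rewrite -(pair_bigA _ (fun i j => d.+2%:R^-1 *: w i j * ('X_i * 'X_j))) /=.
have -> : p = d.+2%:R^-1 *: (d.+2%:R *: p).
  by rewrite scalerA mulVf ?scale1r // charP.
rewrite -(euler_homog hp) scaler_sumr; apply: eq_bigr => i _.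
rewrite def_w mulr_sumr scaler_sumr; apply: eq_bigr => j _.
by rewrite -scalerAl mulrCA.
Qed.

Lemma dhomog_det (k : fieldType) (n m d : nat) (M : 'M[{mpoly k[n]}]_m) :
  (forall i j, M i j \is d.-homog) -> \det M \is (m * d).-homog.
Proof.
move=> hM; rewrite /determinant; apply: rpred_sum => s _.
suff : \prod_i M i (s i) \is (m * d).-homog.
  by rewrite mulr_sign; case: (odd_perm s); rewrite ?rpredN.
rewrite -big_enum -[m in (m * d)%N]size_enum_ord /=.
elim: (enum _) => [|i r IHr]; first by rewrite big_nil; exact: dhomog1.
by rewrite big_cons mulSn dhomogM.
Qed.

(** * Divisors with a linear basis of logarithmic derivations *)

Section LinearBasis.

Variables (k : fieldType) (f : {mpoly k[3]}).
Variables (theta : 'I_3 -> 'I_3 -> {mpoly k[3]}) (c : 'I_3 -> k).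
Variable b : 'I_3 -> {mpoly k[3]} -> {mpoly k[3]}.
Hypothesis char0 : [pchar k] =i pred0.
Hypothesis f0 : f != 0.
Hypothesis homog_f : f \is 3.-homog.
Hypothesis red_f : reduced f.
Hypothesis def_b : forall i, b i = vector_field (theta i).
Hypothesis basis_b : free_basis (log_derivation f) b.
Hypothesis homog_theta : forall i j, theta i j \is 1.-homog.
Hypothesis eigen_theta : forall i, vector_field (theta i) f = c i *: f.
Hypothesis theta_euler : forall i, theta ord_max i = 'X_i.

Let three0 : 3%:R != 0 :> k.
Proof. by have /pcharf0P -> := char0. Qed.

Lemma log_derivation_coord g q : vector_field g f = q * f ->
  exists w : 'I_3 -> {mpoly k[3]}, forall i, g i = \sum_j w j * theta j i.
Proof.
move=> def_q; have [_ gen _] := basis_b.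
have [|w def_w] := gen (vector_field g).
  by split; [apply: vector_field_derivation | exists q].
exists w => i; rewrite -[LHS]vector_fieldX def_w; apply: eq_bigr => j _.
by rewrite def_b vector_fieldX.
Qed.

(** A linear relation between the partial derivatives is a logarithmic field
    with constant coefficients, whereas the fields [theta i] vanish at the
    origin. *)
Lemma linear_basis_standing : standing_convention f.
Proof.
split=> //; first by exists 3.
  exact: dhomog_in_ideal2 homog_f.
move=> a a0 i; have [|w def_w] := @log_derivation_coord (fun j => (a j)%:MP) 0.
  by rewrite mul0r -[RHS]a0; apply: eq_bigr => j _; rewrite mul_mpolyC.
rewrite -[a i](mpolyCK 3) def_w raddf_sum big1 // => j _ /=.
rewrite rmorphM /= [X in _ * X](dhomog_nemf_coeff (homog_theta j i)) ?mulr0 //.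
by rewrite /= mdeg0.
Qed.

(** The syzygies of the partial derivatives are the vector fields that kill
    [f]. Since [theta i] multiplies [f] by [c i], and the Euler field multiplies
    it by [3], they are generated by the fields [3 * theta i - c i * euler] for
    the two indices other than that of the Euler field. *)
Lemma linear_basis_presentation : linearly_presented (in_jacobian_ideal f).
Proof.
have c3 : c ord_max = 3%:R.
  have := eigen_theta ord_max; rewrite /vector_field.
  under eq_bigr do rewrite theta_euler.
  rewrite (euler_homog homog_f) => /eqP; rewrite -subr_eq0 -scalerBl.
  by rewrite scaler_eq0 (negPf f0) orbF subr_eq0 => /eqP.
pose w3 := widen_ord (leqnSn 2).
pose phi : 'M[{mpoly k[3]}]_(3, 2) :=
  \matrix_(i, j) (3%:R *: theta (w3 j) i - c (w3 j) *: 'X_i).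
have homog_phi i j : phi i j \is 1.-homog.
  rewrite mxE rpredB ?rpredZ //.
  by rewrite dhomogX /= mdeg1.
pose grad : 'rV[{mpoly k[3]}]_3 := \row_i f^`M(i).
have phiE (w : 'cV[{mpoly k[3]}]_2) i : (phi *m w) i 0 =
    \sum_j (3%:R *: w j 0) * theta (w3 j) i - (\sum_j c (w3 j) *: w j 0) * 'X_i.
  rewrite mxE mulr_suml -sumrB; apply: eq_bigr => j _.
  by rewrite mxE mulrBl -!scalerAl [_ * w j 0]mulrC ['X_i * _]mulrC.
have gradE (v : 'cV[{mpoly k[3]}]_3) :
    (grad *m v) 0 0 = vector_field (fun i => v i 0) f.
  by rewrite mxE; apply: eq_bigr => i _; rewrite mxE mulrC.
exists grad, phi; split.
- split=> [i|i j t].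
    by rewrite mxE dhomog_mderiv.
  by move=> /(dhomog_mf (homog_phi i j)) /= ->.
- by move=> i j; apply: dhomog_in_ideal (homog_phi i j).
- move=> p; split=> [[a ->]|[v ->]].
    exists (\col_i a i); rewrite gradE /vector_field; apply: eq_bigr => i _.
    by rewrite mxE.
  by exists (fun i => v i 0); rewrite gradE.
- move=> v; split=> [gv0|[w ->]].
    have vf0 : vector_field (fun i => v i 0) f = 0 by rewrite -gradE gv0 mxE.
    have [|w def_w] := @log_derivation_coord (fun i => v i 0) 0.
      by rewrite mul0r.
    (* Applying both sides of [def_w] to [f] gives the coefficient of the
       Euler field in terms of the two others. *)
    have wc0 : \sum_j w j * (c j)%:MP = 0.
      apply: (mulIf f0); rewrite mul0r -[RHS]vf0 /vector_field.
      under [RHS]eq_bigr do rewrite def_w mulr_suml.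
      rewrite exchange_big mulr_suml; apply: eq_bigr => j _ /=.
      rewrite -mulrA mul_mpolyC -eigen_theta mulr_sumr.
      by apply: eq_bigr => i _; rewrite mulrA.
    exists (\col_j (3%:R^-1 *: w (w3 j))); apply/colP => i; rewrite phiE def_w.
    rewrite big_ord_recr /= theta_euler; congr (_ + _).
      by apply: eq_bigr => j _; rewrite mxE scalerA divff ?scale1r.
    rewrite -mulNr; congr (_ * _).
    move: wc0; rewrite big_ord_recr /= c3 => /(canRL (addKr _)).
    rewrite addr0 mulrC mul_mpolyC => /(congr1 ( *:%R 3%:R^-1)).
    rewrite scalerA mulVf // scale1r => ->; rewrite scalerN; congr (- _).
    rewrite scaler_sumr; apply: eq_bigr => j _.
    by rewrite mxE mulrC mul_mpolyC !scalerA mulrC.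
  apply/rowP => j; rewrite ord1 gradE [RHS]mxE.
  under [LHS]eq_bigr do rewrite phiE mulrBl -mulrA.
  rewrite sumrB -mulr_sumr (euler_homog homog_f).
  under eq_bigr do rewrite mulr_suml.
  rewrite exchange_big mulr_suml -sumrB big1 // => l _ /=.
  under eq_bigr do rewrite -mulrA.
  rewrite -mulr_sumr -/(vector_field _ _) eigen_theta -!scalerAl -!scalerAr !scalerA.
  by rewrite mulrC subrr.
- move=> w phiw0; have [_ _ indep] := basis_b.
  (* The coefficients, on the basis, of the vector field [phi *m w]. *)
  pose W i := if unlift ord_max i is Some l then 3%:R *: w l 0
    else - \sum_j c (w3 j) *: w j 0.
  have Ww3 j : W (w3 j) = 3%:R *: w j 0.
    have -> : w3 j = lift ord_max j.
      by apply: val_inj; rewrite /= /bump leqNgt ltn_ord.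
    by rewrite /W liftK.
  have W0 : forall i, W i = 0.
    apply: indep => p; under eq_bigr do rewrite def_b mulr_sumr.
    rewrite exchange_big big1 // => i _ /=; under eq_bigr do rewrite mulrA.
    rewrite -mulr_suml big_ord_recr /= theta_euler {2}/W unlift_none.
    under eq_bigr do rewrite Ww3.
    by rewrite mulNr -phiE phiw0 mxE mul0r.
  apply/colP => j; have /eqP := W0 (w3 j).
  by rewrite Ww3 scaler_eq0 (negPf three0) mxE => /eqP.
Qed.

Lemma linear_basis_linear_free_divisor : linear_free_divisor f.
Proof.
split; last exact: linear_basis_presentation.
by split; [exact: linear_basis_standing | exists 3, b].
Qed.

End LinearBasis.

(** * The Jacobian determinant of the minors *)

Lemma det_mx3 (R : comNzRingType) (M : 'M[R]_3) :
  \det M = M 0 0 * (M 1 1 * M 2 2 - M 1 2 * M 2 1)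
         - M 0 1 * (M 1 0 * M 2 2 - M 1 2 * M 2 0)
         + M 0 2 * (M 1 0 * M 2 1 - M 1 1 * M 2 0).
Proof.
rewrite (expand_det_row _ 0) !big_ord_recl big_ord0 /cofactor.
rewrite ![\det (row' _ _)](expand_det_row _ 0) !big_ord_recl !big_ord0.
rewrite /cofactor !det_mx11 !mxE.
(* The indices produced by the expansion differ from literals by their proofs;
   reading entries at natural numbers identifies them. *)
pose f := fun i j : nat => M (inord i) (inord j).
have fE i j : M i j = f i j by rewrite /f !inord_val.
rewrite !fE /= /bump /=; ring.
Qed.

Section LinearFields.

Variables (k : fieldType) (a1 a2 a3 a4 a5 a6 a7 a8 a9 : k).

Let x : {mpoly k[3]} := varx.
Let y : {mpoly k[3]} := vary.
Let z : {mpoly k[3]} := varz.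
Let L1 := a1 *: x + a2 *: y + a3 *: z.
Let L2 := a4 *: x + a5 *: y + a6 *: z.
Let L3 := a7 *: x + a8 *: y + a9 *: z.
Let N1 := a1 *: L1 + a2 *: L2 + a3 *: L3.
Let N2 := a4 *: L1 + a5 *: L2 + a6 *: L3.
Let N3 := a7 *: L1 + a8 *: L2 + a9 *: L3.
Let theta := vec3 (vec3 N1 N2 N3) (vec3 L1 L2 L3) (vec3 x y z).
Let det_theta := \det (\matrix_(i, j) theta i j).

Let det_thetaE : det_theta =
  N1 * (L2 * z - L3 * y) - N2 * (L1 * z - L3 * x) + N3 * (L1 * y - L2 * x).
Proof. by rewrite /det_theta det_mx3 !mxE. Qed.

(** Write [v ^ w] for the cross product of vectors. The minors are, up to order
    and signs, the entries of [v ^ Av], whose differential sends [v] to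
    [2 (v ^ Av)], [Av] to [v ^ AAv] and [AAv] to [AAv ^ Av + v ^ AAAv]; by
    Cayley-Hamilton [v ^ AAAv] is a combination of the first two images. So the
    Jacobian determinant times [det (AAv, Av, v)] is, up to sign, twice the
    determinant of the pairwise cross products of [v], [Av] and [AAv], that is
    [2 * det (AAv, Av, v) ^+ 2]. The direct expansion below also gives the
    sign. *)
Lemma jacobian_det_linear_fields :
  \det (jacobian_matrix
      (vec3 (x * L2 - y * L1) (x * L3 - z * L1) (y * L3 - z * L2))) =
    2%:R *: det_theta.
Proof.
rewrite det_thetaE det_mx3.
have jacE (Q : 'I_3 -> {mpoly k[3]}) i j : jacobian_matrix Q i j = (Q j)^`M(i).
  by rewrite mxE.
rewrite !jacE /vec3 /= !(mderivB, mderivM, mderivD, mderivZ, mderivXU) /=.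
rewrite -!mul_mpolyC /N1 /N2 /N3 /L1 /L2 /L3 -!mul_mpolyC mpolyC_nat.
move: (a1%:MP) (a2%:MP) (a3%:MP) (a4%:MP) (a5%:MP) (a6%:MP) (a7%:MP) (a8%:MP)
  (a9%:MP) => A1 A2 A3 A4 A5 A6 A7 A8 A9.
by ring.
Qed.

(** Differentiating [det (AAv, Av, v)] along the linear field [Bv], where [B]
    commutes with [A], replaces in turn each of the three vectors by its image
    under [B]; the sum of the results is the trace of [B] times the determinant.
    The scalars are the traces of [A^2], [A] and the identity. *)
Lemma linear_fields_eigen i :
  vector_field (theta i) det_theta =
    vec3 (a1 ^+ 2 + a5 ^+ 2 + a9 ^+ 2 + 2%:R * (a2 * a4 + a3 * a7 + a6 * a8))
         (a1 + a5 + a9) 3%:R i *: det_theta.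
Proof.
have Vx : vector_field (theta i) x = theta i 0 by apply: vector_fieldX.
have Vy : vector_field (theta i) y = theta i 1 by apply: vector_fieldX.
have Vz : vector_field (theta i) z = theta i 2 by apply: vector_fieldX.
rewrite det_thetaE /N1 /N2 /N3 /L1 /L2 /L3 -!mul_mpolyC.
rewrite !(vector_fieldD, vector_fieldM, vector_fieldN, vector_fieldC, Vx, Vy, Vz).
rewrite {Vx Vy Vz} /theta /vec3; case: i => -[|[|[|//]]] ? /=;
rewrite /N1 /N2 /N3 /L1 /L2 /L3 -?mul_mpolyC
  ?(mpolyCD, mpolyCM, mpolyC_nat, rmorphXn) /=;
move: (a1%:MP) (a2%:MP) (a3%:MP) (a4%:MP) (a5%:MP) (a6%:MP) (a7%:MP) (a8%:MP)
  (a9%:MP) => A1 A2 A3 A4 A5 A6 A7 A8 A9;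
ring.
Qed.

End LinearFields.

Theorem theorem5p1 (k : fieldType) (hk : [pchar k] =i pred0)
    (a1 a2 a3 a4 a5 a6 a7 a8 a9 : k) :
  let x : {mpoly k[3]} := varx in
  let y : {mpoly k[3]} := vary in
  let z : {mpoly k[3]} := varz in
  let L1 := a1 *: x + a2 *: y + a3 *: z in
  let L2 := a4 *: x + a5 *: y + a6 *: z in
  let L3 := a7 *: x + a8 *: y + a9 *: z in
  let Q1 := x * L2 - y * L1 in
  let Q2 := x * L3 - z * L1 in
  let Q3 := y * L3 - z * L2 in
  let Theta := jacobian_matrix (vec3 Q1 Q2 Q3) in
  let f := \det Theta in
  let theta1 := vector_field (vec3 (a1 *: L1 + a2 *: L2 + a3 *: L3)
                                   (a4 *: L1 + a5 *: L2 + a6 *: L3)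
                                   (a7 *: L1 + a8 *: L2 + a9 *: L3)) in
  let theta2 := vector_field (vec3 L1 L2 L3) in
  let eps3 := vector_field (vec3 x y z) in
  Q1 != 0 \/ Q2 != 0 \/ Q3 != 0 ->
  f != 0 ->
  reduced f ->
  linear_free_divisor f /\
  free_basis (log_derivation f) (vec3 theta1 theta2 eps3).
Proof.
move=> x y z L1 L2 L3 Q1 Q2 Q3 Theta f theta1 theta2 eps3 _ f0 red_f.
pose theta := vec3
  (vec3 (a1 *: L1 + a2 *: L2 + a3 *: L3) (a4 *: L1 + a5 *: L2 + a6 *: L3)
        (a7 *: L1 + a8 *: L2 + a9 *: L3)) (vec3 L1 L2 L3) (vec3 x y z).
pose b := vec3 theta1 theta2 eps3.
have two0 : 2%:R != 0 :> k by have /pcharf0P -> := hk.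
have def_b i : b i = vector_field (theta i) by case: i => -[|[|[|]]].
have homog_theta i j : theta i j \is 1.-homog.
  have homogX l : ('X_l : {mpoly k[3]}) \is 1.-homog by rewrite dhomogX /= mdeg1.
  by case: i => -[|[|[|//]]] ?; case: j => -[|[|[|//]]] ?;
    rewrite /theta /vec3 /= ?rpredD ?rpredZ ?rpredD ?rpredZ ?homogX.
have theta_euler i : theta ord_max i = 'X_i.
  by case: i => -[|[|[|//]]] lti; congr 'X_(_); apply: val_inj.
pose det_theta := \det (\matrix_(i, j) theta i j).
have def_f : f = 2%:R *: det_theta by apply: jacobian_det_linear_fields.
have homog_f : f \is 3.-homog.
  by rewrite def_f rpredZ // (@dhomog_det _ _ _ 1) // => i j; rewrite mxE.
pose c := vec3
  (a1 ^+ 2 + a5 ^+ 2 + a9 ^+ 2 + 2%:R * (a2 * a4 + a3 * a7 + a6 * a8))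
  (a1 + a5 + a9) 3%:R.
have eigen_f i : vector_field (theta i) f = c i *: f.
  have def_c : vector_field (theta i) det_theta = c i *: det_theta.
    exact: linear_fields_eigen.
  by rewrite def_f vector_fieldZ def_c !scalerA mulrC.
have basis_b : free_basis (log_derivation f) b.
  apply: (@saito_criterion k f theta 2%:R^-1) => //; first by rewrite invr_eq0.
    by move=> i; exists (c i)%:MP; rewrite mul_mpolyC.
  by rewrite def_f scalerA mulVf // scale1r.
split=> //.
exact: (linear_basis_linear_free_divisor hk f0 homog_f red_f def_b basis_b
  homog_theta eigen_f theta_euler).
Qed.
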